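(* Let $n \geq 6$ be an even integer and let $r$ be a positive integer. Suppose $Q_{n-2}$ can be decomposed into cycles $C_1, C_2, \dots, C_s$, each of length $r(n-2)$ (so that $s = 2^{n-3}/r$), such that each $C_i$ contains $r$ edges $e_{i1}, e_{i2}, \dots, e_{ir}$ whose removal from $C_i$ leaves $r$ vertex-disjoint paths of length $n-3$, and such that the set $\{e_{ij} : j = 1, \dots, r;\ i = 1, \dots, s\}$ is a perfect matching of $Q_{n-2}$. Then $Q_n$ can be decomposed into cycles $Z_1, Z_2, \dots, Z_{4s}$, each of length $rn$, such that each $Z_i$ contains $r$ edges $f_{i1}, f_{i2}, \dots, f_{ir}$ whose removal from $Z_i$ leaves $r$ vertex-disjoint paths of length $n-1$, and such that the set $\{f_{ij} : j = 1, \dots, r;\ i = 1, \dots, 4s\}$ is a perfect matching of $Q_n$.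
   Context: $Q_k$ is the $k$-dimensional hypercube (vertices: binary $k$-tuples; edges: pairs differing in exactly one coordinate). A decomposition into cycles is a partition of the edge set into edge sets of cycles. Lengths are numbers of edges. A perfect matching is a set of pairwise vertex-disjoint edges covering every vertex. *)

(* Defs.v *)
From mathcomp Require Import all_boot.

Set Implicit Arguments.
Unset Strict Implicit.
Unset Printing Implicit Defensive.

Definition hypercube (k : nat) : rel (k.-tuple bool) :=
  fun x y => #|[set i | tnth x i != tnth y i]| == 1.
Arguments hypercube : clear implicits.

(* A simple graph is given by its (symmetric, irreflexive) adjacency relation;
   an undirected edge is the two-element set of its ends. *)
Section Graphs.

Variables (T : finType) (adj : rel T).

Definition graph_edges : {set {set T}} :=
  [set [set u.1; u.2] | u in [pred u : T * T | adj u.1 u.2]].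

(* A cycle is listed by its vertices, in cyclic order; the size condition rules
   out a single edge walked back and forth, which [ucycle] would allow. *)
Definition is_cycle (c : seq T) : Prop := ucycle adj c /\ 3 <= size c.

Definition cycle_edges (c : seq T) : {set {set T}} :=
  [set [set x; next c x] | x in c].

Definition is_path (p : seq T) : Prop := [/\ p != [::], uniq p & sorted adj p].

Definition path_edges (p : seq T) : {set {set T}} :=
  [set:: [seq [set u.1; u.2] | u <- zip p (behead p)]].

(* A [partition] is a set of blocks, so injectivity is what makes [C] list each
   cycle once. *)
Definition cycle_decomposition (s : nat) (C : 'I_s -> seq T) : Prop :=
  [/\ forall i, is_cycle (C i),
      injective (fun i => cycle_edges (C i)) &
      partition [set cycle_edges (C i) | i : 'I_s] graph_edges].

(* The graph with the vertices of [c] and the edges of [c] not in [F] is the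
   disjoint union of [r] paths with [m] edges each. *)
Definition removal_leaves_paths (c : seq T) (F : {set {set T}}) (r m : nat) :
    Prop :=
  exists p : 'I_r -> seq T,
    [/\ forall j, is_path (p j) /\ #|path_edges (p j)| = m,
        forall j k, j != k -> [disjoint p j & p k],
        \bigcup_j [set x in p j] = [set x in c] &
        \bigcup_j path_edges (p j) = cycle_edges c :\: F].

Definition perfect_matching (M : {set {set T}}) : Prop :=
  [/\ M \subset graph_edges, trivIset M & cover M = [set: T]].

End Graphs.

(* Main.v *)
(* Write Q_n as four copies of Q_(n-2), the layers, placed around a 4-cycle.
   Draw C_i in layer k, and replace each edge e_ij = xy of it by the path that
   steps from x to layer k+1, traverses the copy of xy there, and steps back at
   y.  This lengthens the cycle by 2r; an edge of layer k is used by the cycle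
   of layer k, or of layer k-1 if it belongs to the matching, and each vertical
   edge is used once because the e_ij form a perfect matching.  The copies of
   the e_ij in layer k+1 serve as the new f_ij: they are again equally spaced,
   as every old path gains a vertical edge at both ends. *)
Require Import Defs.
From mathcomp Require Import all_boot.

Set Implicit Arguments.
Unset Strict Implicit.
Unset Printing Implicit Defensive.

(** * Edge sets of paths and of cycles *)

Section Edges.

Variable T : finType.
Implicit Types (x y : T) (p c : seq T) (A B : {set T}).

Lemma set2_inj x : injective (fun y => [set x; y]).
Proof.
move=> y z /= /setP E.
have := E z; have := E y; rewrite !inE !eqxx !orbT.
by case: eqP => [->|_] /=; case: eqP => // ->; case: eqP.
Qed.

Lemma path_edges_cons2 x y p :
  path_edges (x :: y :: p) = [set x; y] |: path_edges (y :: p).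
Proof. by apply/setP => A; rewrite !inE. Qed.

Lemma path_edges1 x : path_edges [:: x] = set0.
Proof. by apply/setP => A; rewrite !inE. Qed.

(** Unlike the set, the list on the right keeps repetitions and order; counting matching edges along
    a walk and ruling out repeated ones are done on it. *)
Lemma path_edges_pairmap x p :
  path_edges (x :: p) =i pairmap (fun u v => [set u; v]) x p.
Proof.
elim: p x => [|y p IHp] x A; first by rewrite path_edges1 inE.
by rewrite path_edges_cons2 in_setU1 IHp /= in_cons.
Qed.

Lemma path_edgesP p A :
  reflect (exists a u v b, p = a ++ u :: v :: b /\ A = [set u; v])
          (A \in path_edges p).
Proof.
elim: p => [|x [|y p] IHp].
- rewrite inE; right => -[[|? ?] [u [v [b []]]]] //.
- by rewrite path_edges1 inE; right => -[[|? [|? ?]] [u [v [b []]]]].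
rewrite path_edges_cons2 in_setU1; apply: (iffP orP).
  case=> [/eqP ->|/IHp [a [u [v [b [-> ->]]]]]]; first by exists [::], x, y, p.
  by exists (x :: a), u, v, b.
case=> -[|z a] [u [v [b []]]] /=; first by case=> -> -> _ ->; left.
by case=> _ E EA; right; apply/IHp; exists a, u, v, b.
Qed.

Lemma mem_path_edges p A x : A \in path_edges p -> x \in A -> x \in p.
Proof.
case/path_edgesP=> a [u [v [b [-> ->]]]].
by rewrite !inE mem_cat !inE => /orP [] ->; rewrite ?orbT.
Qed.

Lemma path_edges_rev p : path_edges (rev p) = path_edges p.
Proof.
suff H (q : seq T) : path_edges q \subset path_edges (rev q).
  by apply/eqP; rewrite eqEsubset H andbT -{2}(revK p) H.
apply/subsetP => A /path_edgesP [a [u [v [b [-> ->]]]]]; apply/path_edgesP.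
exists (rev b), v, u, (rev a).
by rewrite setUC rev_cat !rev_cons -!cats1 -!catA.
Qed.

Lemma path_edges_rcons2 p x y :
  path_edges (rcons (rcons p x) y) = [set x; y] |: path_edges (rcons p x).
Proof.
rewrite -path_edges_rev !rev_rcons path_edges_cons2 -rev_rcons.
by rewrite path_edges_rev [[set y; x]]setUC.
Qed.

Lemma sorted_adjacent (e : rel T) p u v a b :
  sorted e p -> p = a ++ u :: v :: b -> e u v.
Proof.
move=> + E; rewrite {p}E; case: a => [|x a] /=; first by case/andP.
by rewrite cat_path /= => /and4P [].
Qed.

Lemma path_edges_head x p A B : uniq (x :: p) ->
  A \in path_edges (x :: p) -> B \in path_edges (x :: p) ->
  x \in A -> x \in B -> A = B.
Proof.
(* The first vertex does not recur, so an edge at it can only be the first one. The default of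
   [head] is harmless, since a single vertex has no edges. *)
suff H (C : {set T}) : uniq (x :: p) -> C \in path_edges (x :: p) -> x \in C ->
    C = [set x; head x p].
  by move=> Up /H EA /H EB /EA -> // /EB ->.
move=> /= /andP [xp _] /path_edgesP [[|z a] [u [v [b []]]]] /=.
  by case=> -> -> ->.
case=> _ E ->; move: xp; rewrite E mem_cat !inE.
by move=> /norP [_] /norP [/negPf -> /norP [/negPf -> _]].
Qed.

(** Reversing [p] swaps the two alternatives, so facts about the first vertex transfer to the last.
    The empty list has no endpoint. *)
Definition endpoint p x := exists q, p = x :: q \/ p = rcons q x.

Lemma endpoint_cons p x y : endpoint (x :: p) y <-> y = x \/ y = last x p.
Proof.
split=> [[q [[-> _]|]]|[] ->].
- by left.
- by move/(congr1 (last x)); rewrite last_rcons /= => ->; right.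
- by exists p; left.
- by exists (belast x p); right; rewrite lastI.
Qed.

Lemma mem_endpoint p x : endpoint p x -> x \in p.
Proof. by case=> q [] ->; rewrite ?mem_rcons mem_head. Qed.

Lemma path_edges_endpoint p x A B : uniq p -> endpoint p x ->
  A \in path_edges p -> B \in path_edges p -> x \in A -> x \in B -> A = B.
Proof.
move=> + [q [] E]; rewrite {p}E; first exact: path_edges_head.
rewrite -rev_uniq -path_edges_rev rev_rcons; exact: path_edges_head.
Qed.

Lemma card_path_edges p : uniq p -> #|path_edges p| = (size p).-1.
Proof.
elim: p => [|x [|y p] IHp] Up; first 1 last.
- by rewrite path_edges1 cards0.
- rewrite path_edges_cons2 cardsU1 IHp; last by case/andP: Up.
  suff -> : [set x; y] \notin path_edges (y :: p) by [].
  apply/negP => /mem_path_edges /(_ (set21 x y)).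
  by case/andP: Up => /negP.
- by apply/eqP; rewrite cards_eq0; apply/eqP/setP => A; rewrite !inE.
Qed.

(** Putting the last vertex in front turns the closing edge into an ordinary step, so that cycles
    can be treated by induction along paths. The default [x0] shows only for empty [c], where both
    sides are empty. *)
Lemma cycle_edges_path x0 c : uniq c ->
  cycle_edges c = path_edges (last x0 c :: c).
Proof.
move=> Uc; have lastc : c != [::] -> last x0 c \in c.
  by case: {Uc} c => // y c _; rewrite /= mem_last.
(* With membership in the path edges taken as an adjacency relation, [c] is a cycle, and
   [next_cycle] yields the first inclusion. *)
pose e u v := [set u; v] \in path_edges (last x0 c :: c).
apply/setP/subset_eqP/andP; split; apply/subsetP => A.
  case/imsetP=> x xc ->; apply: (@next_cycle _ e) => //.
  rewrite (cycle_path x0).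
  suff H (b : seq T) z : {subset path_edges (z :: b) <= path_edges (last x0 c :: c)}
      -> path e z b by exact: H.
  elim: b z => //= y b IHb z sub; rewrite {1}/e sub ?IHb //.
    by move=> B Bb; apply: sub; rewrite path_edges_cons2 in_setU1 Bb orbT.
  by rewrite path_edges_cons2 setU11.
case/path_edgesP=> a [u [v [b [E ->]]]].
have uc : u \in c.
  have : u \in last x0 c :: c by rewrite E mem_cat mem_head orbT.
  rewrite inE => /orP [/eqP ->|//]; apply: lastc.
  by case: (c) E => //; case: (a) => [|? []].
(* For the other inclusion, consecutive entries are related by [next c]. *)
have : path (frel (next c)) (last x0 c) c.
  by rewrite -cycle_path cycle_next.
by move/(@sorted_adjacent _ (_ :: _))/(_ E)/eqP <-; apply: imset_f.
Qed.

Lemma next_next_neq c x : uniq c -> 3 <= size c -> x \in c ->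
  next c (next c x) != x.
Proof.
move=> Uc sc xc; have [i q E] := rot_to xc.
rewrite -(next_rot i Uc x) -(next_rot i Uc) E.
move: Uc sc; rewrite -(rot_uniq i) -(size_rot i) E.
case: q {E} => [|y [|z q]] //= /and3P [/norP [xy /norP [xz _]] /norP [yz _] _] _.
by rewrite eqxx (eq_sym y) (negPf xy) eqxx eq_sym.
Qed.

(** Two vertices giving the same edge would be each other's successor, and two steps would return to
    the start, impossible on three or more vertices. *)
Lemma next_edge_inj c : uniq c -> 3 <= size c ->
  {in c &, injective (fun x => [set x; next c x])}.
Proof.
move=> Uc sc x y xc yc /= /setP E; apply/eqP/negPn/negP => xy.
have := E x; rewrite !inE eqxx (negPf xy) /= => /esym/eqP Ex.
have := E y; rewrite !inE eqxx eq_sym (negPf xy) /= => /eqP Ey.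
by have := next_next_neq Uc sc xc; rewrite -Ey -Ex eqxx.
Qed.

Lemma card_cycle_edges c : uniq c -> 3 <= size c -> #|cycle_edges c| = size c.
Proof.
by move=> Uc sc; rewrite card_in_imset ?(card_uniqP Uc) //; apply: next_edge_inj.
Qed.

(** By counting: the list has [size c] entries and equally many distinct values. *)
Lemma uniq_cycle_edges x0 c : uniq c -> 3 <= size c ->
  uniq (pairmap (fun u v => [set u; v]) (last x0 c) c).
Proof.
move=> Uc sc; apply/card_uniqP; rewrite size_pairmap -card_cycle_edges //.
by apply: eq_card => A; rewrite (cycle_edges_path x0) // path_edges_pairmap.
Qed.

Lemma mem_cycle_edges c A x : A \in cycle_edges c -> x \in A -> x \in c.
Proof.
by case/imsetP=> y yc ->; rewrite !inE => /orP [] /eqP ->; rewrite ?mem_next.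
Qed.

Lemma cycle_edges_at c A x : uniq c -> A \in cycle_edges c -> x \in A ->
  A = [set x; next c x] \/ A = [set x; prev c x].
Proof.
move=> Uc /imsetP [y yc ->]; rewrite !inE => /orP [] /eqP ->; first by left.
by right; rewrite prev_next // setUC.
Qed.

Lemma next_edge_in c x : x \in c -> [set x; next c x] \in cycle_edges c.
Proof. exact: imset_f. Qed.

Lemma prev_edge_in c x : uniq c -> x \in c -> [set x; prev c x] \in cycle_edges c.
Proof.
move=> Uc xc; apply/imsetP; exists (prev c x); first by rewrite mem_prev.
by rewrite next_prev // setUC.
Qed.

Lemma cycle_edges_graph (adj : rel T) c :
  cycle adj c -> cycle_edges c \subset graph_edges adj.
Proof.
move=> Cc; apply/subsetP => A /imsetP [x xc ->]; apply/imsetP.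
by exists (x, next c x) => //; rewrite inE /= next_cycle.
Qed.

(* In a cycle minus F every vertex has degree 2, less the number of F-edges at
   it, whereas on a path exactly the ends have degree 1. *)
Lemma endpoint_removed (adj : rel T) c (F : {set {set T}}) (r m : nat) x :
  ucycle adj c -> 3 <= size c ->
  F \subset cycle_edges c ->
  forall p : 'I_r -> seq T,
    (forall j, is_path adj (p j) /\ #|path_edges (p j)| = m) ->
    (forall j k, j != k -> [disjoint p j & p k]) ->
    \bigcup_j [set x in p j] = [set x in c] ->
    \bigcup_j path_edges (p j) = cycle_edges c :\: F ->
  (exists j, endpoint (p j) x) <-> x \in cover F.
Proof.
move=> /andP [_ Uc] sc FE p Pp dp Vp Ep.
have inj j A : A \in cycle_edges c -> A \notin F -> x \in A -> x \in p j ->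
    A \in path_edges (p j).
  move=> Ac AF xA xj.
  have : A \in \bigcup_j path_edges (p j) by rewrite Ep inE AF.
  case/bigcupP=> k _ Ak; have [<-//|/eqP/dp/pred0P/(_ x)] := k =P j.
  by rewrite /= xj (mem_path_edges Ak xA).
have pE j A : A \in path_edges (p j) -> (A \in cycle_edges c) && (A \notin F).
  move=> Aj; have : A \in \bigcup_j path_edges (p j) by apply/bigcupP; exists j.
  by rewrite Ep inE andbC.
split=> [[j xj]|].
  have xpj := mem_endpoint xj.
  have xc : x \in c.
    have : x \in \bigcup_j [set x in p j] by apply/bigcupP; exists j; rewrite ?inE.
    by rewrite Vp inE.
  apply/negPn/negP => xF.
  have nF A : x \in A -> A \notin F.
    by move=> xA; apply: contra xF => AF; apply/bigcupP; exists A.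
  have [[_ Upj _] _] := Pp j.
  have := path_edges_endpoint Upj xj
    (inj _ _ (next_edge_in xc) (nF _ (set21 _ _)) (set21 _ _) xpj)
    (inj _ _ (prev_edge_in Uc xc) (nF _ (set21 _ _)) (set21 _ _) xpj)
    (set21 _ _) (set21 _ _).
  move/set2_inj => E; have := next_next_neq Uc sc xc.
  by rewrite E next_prev // eqxx.
case/bigcupP=> B BF xB; have Bc := subsetP FE _ BF.
have : x \in \bigcup_j [set x in p j] by rewrite Vp inE (mem_cycle_edges Bc).
case/bigcupP=> j _; rewrite inE => xj; exists j.
have [[_ Upj _] _] := Pp j; have pEj := pE j.
case/splitPr: xj Upj pEj => a b.
case/lastP: a => [|a u]; first by exists b; left.
case: b => [|w b]; first by exists (rcons a u); rewrite cats1; right.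
move=> Upj pEj.
have uw : u != w.
  apply: contraTneq Upj => ->; rewrite cat_uniq.
  by rewrite /= !mem_rcons !inE eqxx /= !(orbT, andbF).
have /pEj/andP [uc uF] : [set x; u] \in path_edges (rcons a u ++ [:: x, w & b]).
  by apply/path_edgesP; exists a, u, x, (w :: b); rewrite cat_rcons setUC.
have /pEj/andP [wc wF] : [set x; w] \in path_edges (rcons a u ++ [:: x, w & b]).
  by apply/path_edgesP; exists (rcons a u), x, w, b.
(* Only two cycle edges meet [x], so two of the three edges [B], [[set x; u]] and [[set x; w]]
   coincide. Either an edge of [F] then lies outside [F], or [u = w]. *)
case: notF.
case: (cycle_edges_at Uc uc (set21 _ _)) => E1;
case: (cycle_edges_at Uc wc (set21 _ _)) => E2;
case: (cycle_edges_at Uc Bc xB) => E3;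
  by [move: uF; rewrite E1 -E3 BF | move: wF; rewrite E2 -E3 BF
     | move: E1; rewrite -E2 => /set2_inj/eqP; rewrite (negPf uw)].
Qed.

End Edges.

Lemma path_edges_map (T T' : finType) (f : T -> T') (p : seq T) :
  path_edges (map f p) = [set [set f x | x in B] | B : {set T} in path_edges p].
Proof.
elim: p => [|x [|y p] IHp].
- by apply/setP => A; rewrite inE; apply/esym/imsetP => -[B]; rewrite inE.
- by rewrite /= !path_edges1 imset0.
- rewrite [in RHS]path_edges_cons2 imsetU1 -IHp imsetU1 imset_set1 /=.
  by rewrite path_edges_cons2.
Qed.

(** * Partitions given by an indexed family *)

Section IndexedPartition.

Variables (I T : finType) (A : I -> {set T}) (D : {set T}).

(** A nonempty set listed under two indices shares a point with itself, so pointwise disjointness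
    already forces injectivity. *)
Lemma indexed_partitionP : (forall i, A i != set0) ->
  (injective A /\ partition [set A i | i : I] D) <->
  (forall i j x, x \in A i -> x \in A j -> i = j) /\ \bigcup_i A i = D.
Proof.
move=> A0; split=> [[injA /and3P [/eqP covA /trivIsetP triA _]]|[dA <-]].
  split=> [i j x xi xj|].
    apply/eqP/negPn/negP => ij.
    have /pred0P/(_ x) /= := triA _ _
      (imset_f A (erefl : i \in I)) (imset_f A (erefl : j \in I))
      (contra_neq (@injA i j) ij).
    by rewrite xi xj.
  by rewrite -covA cover_imset.
have injA : injective A.
  by move=> i j E; have [x xi] := set0Pn _ (A0 i); apply: (dA i j x); rewrite -?E.
split=> //; apply/and3P; split.
- by rewrite cover_imset.
- apply/trivIsetP => _ _ /imsetP [i _ ->] /imsetP [j _ ->] ij.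
  apply/pred0P => x /=; apply/negP => /andP [xi xj].
  by move: ij; rewrite (dA i j x xi xj) eqxx.
- by apply/negP => /imsetP [i _ /esym/eqP]; rewrite (negPf (A0 i)).
Qed.

End IndexedPartition.

(** * Copies of a graph arranged in layers *)

Section LayeredGraph.

(* [phi x k] is the copy of the vertex [x] in layer [k]. *)
Variables (T K T' : finType) (adj : rel T) (adj' : rel T').
Variables (sigma : K -> K) (phi : T -> K -> T').
Hypothesis adj_irr : irreflexive adj.
Hypothesis sigma_inj : injective sigma.
(** If [sigma] exchanged two layers, both would claim the same vertical edge over each vertex; fixed
    layers are excluded as well. *)
Hypothesis sigma2_neq : forall k, sigma (sigma k) != k.
Hypothesis phi_inj : forall x y k l, phi x k = phi y l -> x = y /\ k = l.
Hypothesis phi_surj : forall v, exists x k, v = phi x k.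
Hypothesis adj_phi : forall x y k l, adj' (phi x k) (phi y l) =
  ((k == l) && adj x y) || ((x == y) && ((l == sigma k) || (k == sigma l))).

Variable M : {set {set T}}.
Hypothesis M_matching : perfect_matching adj M.

Implicit Types (x y z : T) (k l : K) (p c : seq T) (B : {set T}) (A : {set T'}).

Let M_triv : trivIset M. Proof. by case: M_matching. Qed.

Lemma sigma_neq k : sigma k != k.
Proof. by apply: contraNneq (sigma2_neq k) => E; rewrite !E. Qed.

Lemma sigma_surj k : exists l, k = sigma l.
Proof. by exists (invF sigma_inj k); rewrite f_invF. Qed.

Lemma matching_eq B B' x : B \in M -> B' \in M -> x \in B -> x \in B' -> B = B'.
Proof.
move=> BM BM' xB xB'; apply/eqP/negPn/negP => /(trivIsetP M_triv _ _ BM BM').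
by move/pred0P/(_ x); rewrite /= xB xB'.
Qed.

Definition layer k B : {set T'} := [set phi x k | x in B].

Definition vert k x : {set T'} := [set phi x k; phi x (sigma k)].

(* The edges replacing the edge [B] of a cycle drawn in layer [k]. *)
Definition lift k B : {set {set T'}} :=
  if B \in M then layer (sigma k) B |: [set vert k x | x in B]
  else [set layer k B].

Lemma layer2 k x y : layer k [set x; y] = [set phi x k; phi y k].
Proof. by rewrite /layer imsetU1 imset_set1. Qed.

Lemma mem_layer k l B x : (phi x l \in layer k B) = (k == l) && (x \in B).
Proof.
apply/imsetP/andP => [[y yB /phi_inj [-> ->]]|[/eqP -> xB]]; first by rewrite eqxx.
by exists x.
Qed.

Lemma mem_vert k l x y :
  (phi x l \in vert k y) = (x == y) && ((l == k) || (l == sigma k)).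
Proof.
rewrite !inE; apply/orP/andP.
  by case=> /eqP/phi_inj [-> ->]; rewrite !eqxx ?orbT.
by case=> /eqP -> /orP [] /eqP ->; rewrite eqxx; [left|right].
Qed.

Lemma layer_inj k l B B' : B != set0 -> layer k B = layer l B' ->
  k = l /\ B = B'.
Proof.
case/set0Pn=> x xB /setP E.
have := E (phi x k); rewrite !mem_layer eqxx xB /= => /esym/andP [/eqP kl _].
by split=> //; apply/setP => y; have := E (phi y k); rewrite !mem_layer kl eqxx.
Qed.

Lemma layer_vert k l B x : layer k B <> vert l x.
Proof.
move/setP=> E; have := E (phi x l); have := E (phi x (sigma l)).
rewrite !mem_layer !mem_vert !eqxx /= orbT => /andP [/eqP -> _] /andP [].
by rewrite (negPf (sigma_neq l)).
Qed.

Lemma vert_inj k l x y : vert k x = vert l y -> k = l /\ x = y.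
Proof.
move/setP=> E; have := E (phi x k); have := E (phi x (sigma k)).
rewrite !mem_vert !eqxx orbT /= => /esym/andP [/eqP -> H] /esym/andP [_].
case/orP=> [/eqP //|/eqP Ek]; move: H; rewrite Ek (inj_eq sigma_inj).
by rewrite (negPf (sigma2_neq l)) (negPf (sigma_neq l)).
Qed.

(** A copy of an edge outside [M] comes from its own layer, a copy of a matching edge from the
    preceding layer, which is unique as [sigma] is injective. A vertical edge determines its layer
    and vertex, and that vertex lies on only one matching edge. *)
Lemma lift_disjoint k l B B' A : B != set0 ->
  A \in lift k B -> A \in lift l B' -> k = l /\ B = B'.
Proof.
rewrite /lift => B0; have [BM|BM] := ifPn; have [BM'|BM'] := ifPn.
- case/setU1P=> [->|/imsetP [x xB ->]] /setU1P [E|/imsetP [y yB' E]].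
  + by have [/sigma_inj] := layer_inj B0 E.
  + by case: (layer_vert E).
  + by case: (layer_vert (esym E)).
  have [-> Ex] := vert_inj E; split=> //.
  by apply: (matching_eq BM BM' xB); rewrite Ex.
- case/setU1P=> [->|/imsetP [x xB ->]] /set1P E.
    by have [_ EB] := layer_inj B0 E; rewrite -EB BM in BM'.
  by case: (layer_vert (esym E)).
- move=> /set1P -> /setU1P [E|/imsetP [y yB' E]].
    by have [_ EB] := layer_inj B0 E; rewrite -EB (negPf BM) in BM'.
  by case: (layer_vert E).
- by move=> /set1P -> /set1P /(layer_inj B0).
Qed.

(** Vertical edges are reached because [M] covers every vertex. A matching edge in layer [k] is
    reached from the layer that [sigma] sends to [k]. *)
Lemma graph_edges_lift A : A \in graph_edges adj' ->
  exists k B, B \in graph_edges adj /\ A \in lift k B.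
Proof.
have [ME _ /setP covM] := M_matching.
have vertP k x : exists k' B, B \in graph_edges adj /\ vert k x \in lift k' B.
  have /bigcupP [B BM xB] : x \in cover M by rewrite covM.
  exists k, B; rewrite (subsetP ME) // /lift BM; split=> //.
  by rewrite setU1r // imset_f.
case/imsetP=> -[v w]; rewrite inE /= => + ->.
have [x [k ->]] := phi_surj v; have [y [l ->]] := phi_surj w.
rewrite adj_phi => /orP [/andP [/eqP <- xy]|/andP [/eqP <- /orP []/eqP ->]].
- have BE : [set x; y] \in graph_edges adj by apply/imsetP; exists (x, y).
  rewrite -layer2; have [BM|BM] := boolP ([set x; y] \in M).
    have [k' ->] := sigma_surj k; exists k', [set x; y].
    by rewrite /lift BM setU11.
  by exists k, [set x; y]; rewrite /lift (negPf BM) set11.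
- exact: vertP.
- by rewrite setUC; apply: vertP.
Qed.

(** * Expanded cycles *)

Fixpoint detour k x p : seq T' :=
  if p is y :: q then
    (if [set x; y] \in M then [:: phi x (sigma k); phi y (sigma k)] else [::])
    ++ phi y k :: detour k y q
  else [::].

(** As in [path], the start of a [detour] is not listed. Starting from the last vertex of the cycle
    therefore lists every vertex once and handles the closing edge like the others. *)
Definition expand k c : seq T' :=
  if c is x :: _ then detour k (last x c) c else [::].

Lemma last_detour k x p : last (phi x k) (detour k x p) = phi (last x p) k.
Proof. by elim: p x => //= y p IHp x; rewrite last_cat last_cons IHp. Qed.

Lemma path_detour k x p : path adj x p -> path adj' (phi x k) (detour k x p).
Proof.
elim: p x => //= y p IHp x /andP [xy /IHp yp].
by case: ifP => _ /=; rewrite !adj_phi yp !eqxx xy ?orbT.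
Qed.

Lemma size_detour k x p : size (detour k x p) =
  size p + 2 * count [in M] (pairmap (fun u v => [set u; v]) x p).
Proof.
elim: p x => //= y p IHp x; rewrite size_cat /= IHp.
case: ifP => _ /=; rewrite addnS [RHS]addSn; first by rewrite mulnDr [in RHS]addnCA.
by rewrite !add0n.
Qed.

Lemma path_edges_detour k x p :
  path_edges (phi x k :: detour k x p) = \bigcup_(B in path_edges (x :: p)) lift k B.
Proof.
elim: p x => [|y p IHp] x; first by rewrite /= !path_edges1 big_set0.
rewrite [path_edges (x :: _)]path_edges_cons2 bigcup_setU big_set1 -IHp /= /lift.
case: ifP => _ /=; rewrite !path_edges_cons2 ?layer2 //.
rewrite imsetU1 imset_set1 /vert [[set phi y (sigma k); phi y k]]setUC.
by rewrite setUCA -!setUA.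
Qed.

Lemma mem_detour k x p v : v \in detour k x p ->
  (exists2 y, y \in p & v = phi y k) \/
  (exists B y, [/\ B \in M, B \in path_edges (x :: p), y \in B &
                   v = phi y (sigma k)]).
Proof.
elim: p x => //= y p IHp x; rewrite mem_cat inE path_edges_cons2 => /or3P [].
- case: ifP => // BM; rewrite !inE => /orP [] /eqP ->; right.
    by exists [set x; y], x; rewrite !inE !eqxx.
  by exists [set x; y], y; rewrite !inE !eqxx orbT.
- by move/eqP=> ->; left; exists y; rewrite ?mem_head.
case/IHp=> [[z zp ->]|[B [z [BM Bp zB ->]]]].
  by left; exists z; rewrite // inE zp orbT.
by right; exists B, z; rewrite inE Bp orbT.
Qed.

(** In layer [k] the entries are copies of those of [p]. In the next layer they are ends of matching
    edges, which are pairwise disjoint, so a repetition would need some matching edge to occur twice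
    along the walk. *)
Lemma uniq_detour k x p : path adj x p -> uniq p ->
  uniq (pairmap (fun u v => [set u; v]) x p) -> uniq (detour k x p).
Proof.
elim: p x => //= y p IHp x /andP [xy Pp] /andP [yp Up] /andP [xyp Ue].
have yD : phi y k \notin detour k y p.
  apply/negP => /mem_detour [[z zp /phi_inj [yz _]]|[B [z [_ _ _ /phi_inj [_ E]]]]].
    by rewrite yz zp in yp.
  by move: (sigma_neq k); rewrite -E eqxx.
case: ifP => BM; rewrite /= yD IHp //= !andbT.
have D z : z \in [set x; y] -> phi z (sigma k) \notin phi y k :: detour k y p.
  move=> zB; rewrite inE negb_or; apply/andP; split.
    by apply/eqP => /phi_inj [_ /eqP]; rewrite (negPf (sigma_neq k)).
  apply/negP => /mem_detour [[w _ /phi_inj [_ /eqP]]|[B [w [BM' Bp wB /phi_inj [E _]]]]].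
    by rewrite (negPf (sigma_neq k)).
  move: xyp; rewrite -path_edges_pairmap (matching_eq BM BM' zB) ?Bp //.
  by rewrite E.
rewrite inE negb_or D ?set21 // D ?set22 // !andbT.
by apply: contraTneq xy => /phi_inj [-> _]; rewrite adj_irr.
Qed.

Lemma expandE k x c : c != [::] -> expand k c = detour k (last x c) c.
Proof. by case: c. Qed.

Lemma uniq_expand k c : ucycle adj c -> 3 <= size c -> uniq (expand k c).
Proof.
move=> /andP [Cc Uc] sc; case: c Cc Uc sc => // x c Cc Uc sc.
rewrite (expandE _ x) //; apply: uniq_detour; rewrite -?cycle_path //.
exact: uniq_cycle_edges.
Qed.

Lemma cycle_edges_expand k c : ucycle adj c -> 3 <= size c ->
  cycle_edges (expand k c) = \bigcup_(B in cycle_edges c) lift k B.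
Proof.
move=> Hc sc; have UZ := uniq_expand k Hc sc; have /andP [_ Uc] := Hc.
case: c {Hc} Uc sc UZ => // x c Uc sc UZ.
rewrite (cycle_edges_path (phi (last x (x :: c)) k)) //.
rewrite (cycle_edges_path x Uc) -path_edges_detour (expandE _ x) //.
by rewrite last_detour.
Qed.

Lemma size_expand k c : ucycle adj c -> 3 <= size c ->
  size (expand k c) = size c + 2 * #|cycle_edges c :&: M|.
Proof.
move=> /andP [_ Uc] sc; case: c Uc sc => // x c Uc sc.
rewrite (expandE _ x) // size_detour; congr (_ + 2 * _).
(* No edge is listed twice, so the number of matching entries is a cardinality. *)
rewrite -size_filter -(card_uniqP (filter_uniq _ (uniq_cycle_edges x Uc sc))).
apply: eq_card => B; rewrite mem_filter andbC in_setI.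
by rewrite (cycle_edges_path x Uc) path_edges_pairmap.
Qed.

Lemma is_cycle_expand k c : is_cycle adj c -> is_cycle adj' (expand k c).
Proof.
move=> [Hc sc]; split; last first.
  by rewrite size_expand // (leq_trans sc) ?leq_addr.
rewrite /ucycle uniq_expand // andbT; have /andP [Cc Uc] := Hc.
case: c {Hc} sc Cc Uc => // x c _ Cc Uc; rewrite (expandE _ x) //.
rewrite (cycle_path (phi (last x (x :: c)) k)) last_detour path_detour //.
by rewrite -cycle_path.
Qed.

Lemma mem_expandP k c v : ucycle adj c -> 3 <= size c ->
  v \in expand k c <->
  (exists2 x, x \in c & v = phi x k) \/
  (exists2 x, x \in cover (cycle_edges c :&: M) & v = phi x (sigma k)).
Proof.
move=> Hc sc; have /andP [_ Uc] := Hc; split.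
  have c0 : c != [::] by case: (c) sc.
  have [x0 _] : exists x, x \in c by case: (c) c0 => // x q; exists x; rewrite mem_head.
  rewrite (expandE _ x0) // => /mem_detour [|[B [x [BM Bp xB ->]]]]; first by left.
  right; exists x => //; apply/bigcupP; exists B => //.
  by rewrite inE BM andbT (cycle_edges_path x0 Uc).
(* Conversely, it suffices to find a lifted edge through [v]. *)
have inZ A B : A \in lift k B -> B \in cycle_edges c -> v \in A -> v \in expand k c.
  move=> AB Bc; apply: mem_cycle_edges; rewrite cycle_edges_expand //.
  by apply/bigcupP; exists B.
case=> [[x xc E]|[x /bigcupP [B]]]; rewrite ?inE; last first.
  case/andP=> Bc BM xB E; apply: (inZ (layer (sigma k) B) B) => //.
    by rewrite /lift BM setU11.
  by rewrite E mem_layer eqxx.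
(* The edge leaving [x] serves: its lift contains the vertical edge at [x] if it is in [M], and its
   copy in layer [k] otherwise. *)
have Bc := next_edge_in xc; have xB := set21 x (next c x).
have [BM|BM] := boolP ([set x; next c x] \in M).
  apply: (inZ (vert k x) _ _ Bc); last by rewrite E mem_vert !eqxx.
  by rewrite /lift BM setU1r // imset_f.
apply: (inZ (layer k [set x; next c x]) _ _ Bc); last by rewrite E mem_layer eqxx.
by rewrite /lift (negPf BM) set11.
Qed.

(** * Extended paths and the lifted decomposition *)

Definition extend k p : seq T' :=
  if p is x :: _
  then phi x (sigma k) :: rcons [seq phi y k | y <- p] (phi (last x p) (sigma k))
  else [::].

Lemma size_extend k p : p != [::] -> size (extend k p) = (size p).+2.
Proof. by case: p => //= x p _; rewrite size_rcons size_map. Qed.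

Lemma mem_extendP k p v : v \in extend k p <->
  (exists2 x, x \in p & v = phi x k) \/
  (exists2 x, endpoint p x & v = phi x (sigma k)).
Proof.
case: p => [|x p].
  by split=> // -[[]//|[x [q []]]] //; case: q.
rewrite /extend inE mem_rcons inE; split.
  case/or3P=> [/eqP ->|/eqP ->|/mapP [y yp ->]].
  - by right; exists x => //; apply/endpoint_cons; left.
  - by right; exists (last x p) => //; apply/endpoint_cons; right.
  - by left; exists y.
case=> [[y yp ->]|[y /endpoint_cons [] -> ->]]; rewrite ?eqxx ?orbT //.
by rewrite map_f ?orbT.
Qed.

Lemma path_edges_extendP k p A : A \in path_edges (extend k p) <->
  (exists2 B, B \in path_edges p & A = layer k B) \/
  (exists2 x, endpoint p x & A = vert k x).
Proof.
case: p => [|x p].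
  split; first by rewrite inE.
  by case=> [[B]|[x [q []]]] //; [rewrite inE | case: q].
have E : extend k (x :: p) = phi x (sigma k) :: phi x k ::
    rcons [seq phi y k | y <- p] (phi (last x p) (sigma k)) by [].
rewrite E path_edges_cons2 -rcons_cons -map_cons lastI map_rcons.
rewrite path_edges_rcons2 -map_rcons -lastI path_edges_map.
rewrite [[set _ ; phi x k]]setUC !in_setU1; split.
  case/or3P=> [/eqP ->|/eqP ->|/imsetP [B Bp ->]].
  - by right; exists x => //; apply/endpoint_cons; left.
  - by right; exists (last x p) => //; apply/endpoint_cons; right.
  - by left; exists B.
case=> [[B Bp ->]|[y /endpoint_cons [] -> ->]]; rewrite ?eqxx ?orbT //.
by rewrite imset_f ?orbT.
Qed.

(** The two added vertices lie over the ends of [p], which differ once [p] has two vertices; a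
    single vertex would add the same one twice. *)
Lemma is_path_extend k p : is_path adj p -> 1 < size p -> is_path adj' (extend k p).
Proof.
move=> [_ Up Sp] sp; case: p Up Sp sp => // x p Up Sp sp; split=> //.
  have notin z : phi z (sigma k) \notin [seq phi y k | y <- x :: p].
    by apply/mapP => -[y _ /phi_inj [_ /eqP]]; rewrite (negPf (sigma_neq k)).
  rewrite /extend cons_uniq mem_rcons inE negb_or rcons_uniq !notin andbT.
  apply/andP; split.
    apply/eqP => /phi_inj [E _]; case: p {Sp notin} Up E sp => //= y p.
    by move=> /andP [xp _] E; rewrite E mem_last in xp.
  by rewrite (map_inj_uniq (f := phi^~ k)) // => y z /phi_inj [].
rewrite /extend /= rcons_path last_map !adj_phi !eqxx ?orbT /=.
by rewrite path_map andbT; apply: sub_path Sp => y z yz /=; rewrite adj_phi eqxx yz.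
Qed.

(** The bijection [g] numbers the pairs of a layer and a cycle. The bound [1 < m] gives each old
    path at least one edge, as [is_path_extend] requires. *)
Lemma layered_cycle_decomposition (N r s m : nat) (g : 'I_N -> K * 'I_s)
    (C : 'I_s -> seq T) (e : 'I_s -> 'I_r -> {set T}) :
  bijective g -> 1 < m ->
  cycle_decomposition adj C ->
  (forall i, #|cycle_edges (C i)| = r * m) ->
  (forall i, injective (e i) /\ (forall j, e i j \in cycle_edges (C i))) ->
  (forall i, removal_leaves_paths adj (C i) [set e i j | j : 'I_r] r m.-1) ->
  M = [set e i j | i : 'I_s, j : 'I_r] ->
  exists (Z : 'I_N -> seq T') (f : 'I_N -> 'I_r -> {set T'}),
    cycle_decomposition adj' Z /\
    (forall i, #|cycle_edges (Z i)| = r * m.+2) /\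
    (forall i, injective (f i) /\ (forall j, f i j \in cycle_edges (Z i))) /\
    (forall i, removal_leaves_paths adj' (Z i) [set f i j | j : 'I_r] r m.+1) /\
    perfect_matching adj' [set f i j | i : 'I_N, j : 'I_r].
Proof.
move=> [g' gK g'K] m_gt1 [Ccyc Cinj Cpart] Clen e_in e_paths ME.
have C0 i : cycle_edges (C i) != set0.
  have [_ sc] := Ccyc i; case: (C i) sc => // x c _.
  by apply/set0Pn; exists [set x; next (x :: c) x]; rewrite next_edge_in ?mem_head.
have [/(_ (conj Cinj Cpart)) [Cdisj Ccov] _] := indexed_partitionP (graph_edges adj) C0.
have B0 i B : B \in cycle_edges (C i) -> B != set0.
  by case/imsetP=> x _ ->; apply/set0Pn; exists x; rewrite set21.
have eM i j : e i j \in M by rewrite ME; apply/imset2P; exists i j.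
have e0 i j : e i j != set0 by apply: (B0 i); case: (e_in i).
(* A matching edge chosen from another cycle cannot lie on [C i], since the cycles share no
   edges. *)
have MF i : cycle_edges (C i) :&: M = [set e i j | j : 'I_r].
  apply/setP => B; rewrite inE; apply/andP/imsetP => [[Bc]|[j _ ->]]; last first.
    by split=> //; case: (e_in i).
  rewrite {1}ME => /imset2P [i' j _ _ EB]; exists j => //; rewrite EB.
  by congr (e _ j); apply: (Cdisj _ _ B) => //; rewrite EB; case: (e_in i').
pose Z i := expand (g i).1 (C (g i).2).
pose f i j := layer (sigma (g i).1) (e (g i).2 j).
have ucC i : ucycle adj (C i) by case: (Ccyc i).
have scC i : 3 <= size (C i) by case: (Ccyc i).
have ZE i : cycle_edges (Z i) = \bigcup_(B in cycle_edges (C (g i).2)) lift (g i).1 B.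
  exact: cycle_edges_expand.
have Zcyc i : is_cycle adj' (Z i) by apply: is_cycle_expand.
have fZ i j : f i j \in cycle_edges (Z i).
  rewrite ZE; apply/bigcupP; exists (e (g i).2 j); first by case: (e_in (g i).2).
  by rewrite /lift eM setU11.
have f_inj i : injective (f i).
  by move=> j j' /layer_inj [] // _; case: (e_in (g i).2) => + _; apply.
exists Z, f; split; [|split; [|split; [|split]]].
- have Z0 i : cycle_edges (Z i) != set0.
    have [/andP [CZ _] _] := Zcyc i; have [_] := Zcyc i.
    case: (Z i) => // v w _; apply/set0Pn.
    by exists [set v; next (v :: w) v]; apply: next_edge_in; rewrite mem_head.
  suff /(indexed_partitionP (graph_edges adj') Z0).2 [Zinj Zpart] :
    (forall i j A, A \in cycle_edges (Z i) -> A \in cycle_edges (Z j) -> i = j) /\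
    \bigcup_i cycle_edges (Z i) = graph_edges adj' by split.
  split.
    (* A common edge determines the layer and the edge of the base graph, and the latter determines
       the cycle. *)
    move=> i j A; rewrite !ZE => /bigcupP [B Bi AB] /bigcupP [B' Bj AB'].
    have [k1 EB] := lift_disjoint (B0 _ _ Bi) AB AB'; apply: (can_inj gK).
    rewrite -EB in Bj; have := Cdisj _ _ _ Bi Bj; move: k1.
    by case: (g i) (g j) => [? ?] [? ?] /= -> ->.
  apply/eqP; rewrite eqEsubset; apply/andP; split.
    by apply/bigcupsP => i _; apply: cycle_edges_graph; case: (Zcyc i) => /andP [].
  apply/subsetP => A /graph_edges_lift [k [B [BE AB]]].
  move: BE; rewrite -Ccov => /bigcupP [i _ Bi]; apply/bigcupP.
  by exists (g' (k, i)) => //; rewrite ZE g'K; apply/bigcupP; exists B.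
- move=> i; have [/andP [_ UZ] sZ] := Zcyc i.
  have /andP [_ UC] := ucC (g i).2.
  rewrite card_cycle_edges // size_expand // -card_cycle_edges // Clen MF.
  rewrite card_imset; last by case: (e_in (g i).2).
  by rewrite card_ord -(addn2 m) mulnDr (mulnC 2).
- by move=> i.
- move=> i; set k := (g i).1; set c := C (g i).2.
  have [p [Pp dp Vp Ep]] := e_paths (g i).2.
  have szp j : size (p j) = m.
    have [[p0 Up _]] := Pp j; rewrite card_path_edges //.
    by case: (p j) p0 => //= x q _ ->; rewrite prednK // ltnW.
  (* The ends of the old paths are thus exactly the vertices at which the new cycle changes
     layer. *)
  have endP sub x := endpoint_removed x (ucC _) (scC _) sub Pp dp Vp Ep.
  rewrite -MF in endP Ep; have {}endP := endP (subsetIl _ _).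
  exists (fun j => extend k (p j)); split.
  + move=> j; have [Pj _] := Pp j.
    have Pe : is_path adj' (extend k (p j)) by apply: is_path_extend; rewrite ?szp.
    split=> //; have [_ Ue _] := Pe; rewrite card_path_edges // size_extend ?szp //.
    by case: Pj.
  + move=> j j' jj'; apply/pred0P => v /=; apply/negP => /andP [].
    (* Forgetting the layer sends an extended path into the old one, so disjointness is
       inherited. *)
    have sub j1 x l : phi x l \in extend k (p j1) -> x \in p j1.
      by move/mem_extendP => [] [y + /phi_inj [-> _]] => // /mem_endpoint.
    have [x [l ->]] := phi_surj v => /sub xj /sub xj'.
    by have /pred0P/(_ x) := dp _ _ jj'; rewrite /= xj xj'.
  + apply/setP => v; rewrite [in RHS]inE; apply/bigcupP/idP.
      case=> j _; rewrite inE => /mem_extendP [[x xj ->]|[x xj ->]].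
        apply/mem_expandP => //; left; exists x => //.
        have : x \in \bigcup_j [set x in p j] by apply/bigcupP; exists j; rewrite ?inE.
        by rewrite Vp inE.
      by apply/mem_expandP => //; right; exists x => //; apply/endP; exists j.
    case/mem_expandP=> // [[x xc ->]|[x /endP [j xj] ->]].
      have : x \in \bigcup_j [set x in p j] by rewrite Vp inE.
      case/bigcupP=> j _; rewrite inE => xj; exists j => //; rewrite inE.
      by apply/mem_extendP; left; exists x.
    by exists j => //; rewrite inE; apply/mem_extendP; right; exists x.
  + apply/setP => A; rewrite [in RHS]inE ZE; apply/bigcupP/andP.
      case=> j _ /path_edges_extendP [[B Bj ->]|[x xj ->]].
        have : B \in \bigcup_j path_edges (p j) by apply/bigcupP; exists j.
        rewrite Ep !inE => /andP [+ Bc]; rewrite Bc /= => BM; split.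
          apply/imsetP => -[j' _ /layer_inj [|_ EB]]; first exact: B0 Bc.
          by rewrite EB eM in BM.
        by apply/bigcupP; exists B; rewrite // /lift (negPf BM) set11.
      have /endP/bigcupP [B] : exists j, endpoint (p j) x by exists j.
      rewrite inE => /andP [Bc BM] xB; split.
        by apply/imsetP => -[j' _ /esym/layer_vert].
      by apply/bigcupP; exists B; rewrite // /lift BM setU1r // imset_f.
    (* The lift of a matching edge consists of a removed edge and of vertical edges at ends of old
       paths; any other edge lies on an old path. *)
    case=> AF /bigcupP [B Bc]; rewrite /lift; case: ifPn => BM.
      have BF : B \in cycle_edges c :&: M by rewrite inE Bc BM.
      case/setU1P=> [EA|/imsetP [x xB EA]].
        move: BF; rewrite MF => /imsetP [j _ EB]; case/negP: AF.
        by apply/imsetP; exists j; rewrite // EA EB.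
      have /endP [j xj] : x \in cover (cycle_edges c :&: M) by apply/bigcupP; exists B.
      by exists j => //; apply/path_edges_extendP; right; exists x.
    move/set1P=> EA; have : B \in \bigcup_j path_edges (p j).
      by rewrite Ep !inE Bc (negPf BM).
    by case/bigcupP=> j _ Bj; exists j => //; apply/path_edges_extendP; left; exists B.
have [_ _ /setP covM] := M_matching; split.
- apply/subsetP => _ /imset2P [i j _ _ ->].
  by apply: (subsetP (cycle_edges_graph _)) (fZ i j); case: (Zcyc i) => /andP [].
- apply/trivIsetP => _ _ /imset2P [i j _ _ ->] /imset2P [i' j' _ _ ->].
  apply: contraR => /pred0Pn [v /= /andP []]; have [x [l ->]] := phi_surj v.
  rewrite !mem_layer => /andP [/eqP Ek xB] /andP [/eqP El xB'].
  by rewrite /f Ek El (matching_eq (eM _ _) (eM _ _) xB xB').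
- apply/setP => v; rewrite inE; have [x [l ->]] := phi_surj v.
  (* The new matching edge covering a vertex belongs to a cycle drawn one layer earlier. *)
  have [k ->] := sigma_surj l; apply/bigcupP.
  have : x \in cover M by rewrite covM.
  case/bigcupP=> B; rewrite {1}ME => /imset2P [i j _ _ ->] xB.
  exists (f (g' (k, i)) j); first by apply/imset2P; exists (g' (k, i)) j.
  by rewrite mem_layer g'K /= eqxx.
Qed.

End LayeredGraph.

(** * The hypercube as a layered graph *)

Lemma hypercube_cons k a b (x y : k.-tuple bool) :
  hypercube k.+1 [tuple of a :: x] [tuple of b :: y] =
  if a == b then hypercube k x y else x == y.
Proof.
(* Written as a sum, the number of differing coordinates splits off the first; if that one differs,
   the remaining sum must vanish. *)
rewrite /hypercube -!sum1_card.
under eq_bigl do rewrite inE; under [in RHS]eq_bigl do rewrite inE.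
rewrite big_mkcond big_ord_recl -big_mkcond !tnth0.
under eq_bigl do rewrite !tnthS.
case: (a =P b) => _ /=; first by rewrite add0n.
rewrite add1n eqSS sum_nat_eq0.
apply/forallP/eqP => [xy|-> i]; last by rewrite eqxx.
by apply: eq_from_tnth => i; have := xy i; case: eqP.
Qed.

(** The cyclic Gray code 00, 01, 11, 10, which runs around the 4-cycle [Q_2]. *)
Definition gray_succ (k : bool * bool) : bool * bool := (k.2, ~~ k.1).

Definition prepend2 m (x : m.-tuple bool) (k : bool * bool) : m.+2.-tuple bool :=
  [tuple of k.1 :: [tuple of k.2 :: x]].

Lemma prepend2_adj m (x y : m.-tuple bool) k l :
  hypercube m.+2 (prepend2 x k) (prepend2 y l) =
  ((k == l) && hypercube m x y) ||
  ((x == y) && ((l == gray_succ k) || (k == gray_succ l))).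
Proof.
have tupleE a b : ([tuple of a :: x] == [tuple of b :: y]) = (a == b) && (x == y).
  by rewrite -val_eqE.
rewrite !hypercube_cons tupleE.
by case: k l => [[] []] [[] []]; rewrite /= ?andbT ?andbF ?orbF.
Qed.

Theorem theorem4p1 (n r s : nat) (hn : 6 <= n) (n_even : ~~ odd n) (hr : 0 < r)
    (C : 'I_s -> seq ((n - 2).-tuple bool))
    (e : 'I_s -> 'I_r -> {set (n - 2).-tuple bool})
    (C_dec : cycle_decomposition (hypercube (n - 2)) C)
    (C_len : forall i, #|cycle_edges (C i)| = r * (n - 2))
    (e_in : forall i, injective (e i) /\ (forall j, e i j \in cycle_edges (C i)))
    (e_paths : forall i, removal_leaves_paths (hypercube (n - 2)) (C i)
                           [set e i j | j : 'I_r] r (n - 3))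
    (e_pm : perfect_matching (hypercube (n - 2))
              [set e i j | i : 'I_s, j : 'I_r]) :
  exists (Z : 'I_(4 * s) -> seq (n.-tuple bool))
         (f : 'I_(4 * s) -> 'I_r -> {set n.-tuple bool}),
    cycle_decomposition (hypercube n) Z /\
    (forall i, #|cycle_edges (Z i)| = r * n) /\
    (forall i, injective (f i) /\ (forall j, f i j \in cycle_edges (Z i))) /\
    (forall i, removal_leaves_paths (hypercube n) (Z i)
                 [set f i j | j : 'I_r] r (n - 1)) /\
    perfect_matching (hypercube n) [set f i j | i : 'I_(4 * s), j : 'I_r].
Proof.
have [m En m_gt1] : exists2 m, n = m.+2 & 1 < m.
  exists (n - 2); first by rewrite -addn2 subnK // (leq_trans _ hn).
  by rewrite ltn_subRL (leq_trans _ hn).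
subst n; have E3 : m.+2 - 3 = m.-1 by rewrite !subSS subn1.
have E1 : m.+2 - 1 = m.+1 by rewrite subn1.
have E2 : m.+2 - 2 = m by rewrite !subSS subn0.
rewrite E1; rewrite E3 in e_paths.
move: C e C_dec C_len e_in e_paths e_pm; rewrite E2.
move=> C e C_dec C_len e_in e_paths e_pm.
(* The layers are the four pairs of bits, and enumerating layer-cycle pairs provides [g]. *)
have cardI : 4 * s = #|{: (bool * bool) * 'I_s}|.
  by rewrite !card_prod card_bool card_ord.
have g_bij : bijective (fun i : 'I_(4 * s) => enum_val (cast_ord cardI i)).
  by exists (fun u => cast_ord (esym cardI) (enum_rank u)) => i;
    rewrite ?enum_valK ?cast_ordK ?cast_ordKV ?enum_rankK.
apply: (@layered_cycle_decomposition _ _ _ (hypercube m) (hypercube m.+2)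
  gray_succ (@prepend2 m) _ _ _ _ _ _ _ e_pm _ r s m _ C e g_bij) => //.
- move=> x; rewrite /hypercube (_ : [set _ | _] = set0) ?cards0 //.
  by apply/setP => i; rewrite !inE eqxx.
- by move=> [a b] [c d] [-> /(can_inj negbK) ->].
- by case=> [[] []].
- move=> x y [a b] [c d] E; split; last by case: (congr1 val E) => -> ->.
  by apply: val_inj; case: (congr1 val E).
- by move=> v; case/tupleP: v => a v; case/tupleP: v => b x; exists x, (a, b).
- exact: prepend2_adj.
Qed.
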